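(* Let $(S,\mathfrak n)$ be an Artinian Gorenstein local ring, let $K$ be an ideal of $S$, and let $(R,\mathfrak m,k)$ be a local ring of the form $R=S/(0:_SK)$. If $$\operatorname{Fitt}^1_S(K)=\mathfrak n\qquad\text{and}\qquad (\mathfrak nK:_S\mathfrak n)\neq (K:_S\mathfrak n),$$ then the second syzygy of the canonical module $\omega_R$ of $R$, viewed as an $R$-module, has a direct summand isomorphic to $R/\mathfrak m$.
   Context: For ideals $L,M$ of $S$, $(L:_SM)=\{x\in S\mid xM\subseteq L\}$. For a finitely generated module $M$ over a local ring $S$, let $\mu(M)$ be the minimal number of generators of $M$ and let $S^b\xrightarrow{\varphi}S^{\mu(M)}\to M\to 0$ be a presentation; $\operatorname{Fitt}^1_S(M)$ is the ideal of $S$ generated by the entries of $\varphi$. (It equals the usual Fitting ideal $\operatorname{Fitt}_{\mu(M)-1}(M)$, so it is independent of $\varphi$.) A second syzygy module of an $R$-module $M$ is an $R$-module $M'$ for which there is an exact sequence $0\to M'\to P_2\to P_1\to M\to 0$ with $P_1,P_2$ projective $R$-modules. By Schanuel's Lemma it is well defined only up to direct sum with a projective module; ''the second syzygy of $M$ has a direct summand isomorphic to $T$'' is understood in this sense, i.e. some second syzygy module of $M$ (with $P_1,P_2$ finitely generated) has a direct summand isomorphic to $T$. In this situation the canonical module of $R$ is $\omega_R=\operatorname{Hom}_S(R,S)\cong K$. *)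

(* Defs.v *)
From HB Require Import structures.
From mathcomp Require Import all_boot all_algebra.
From mathcomp Require Import boolp classical_sets.

Set Implicit Arguments.
Unset Strict Implicit.
Unset Printing Implicit Defensive.

Import GRing.Theory.
Local Open Scope classical_set_scope.
Local Open Scope ring_scope.

Section Ideals.
Variable S : comNzRingType.
Implicit Types (I J : set S).

(* The unit ideal is allowed, unlike for the boolean [idealr] of
   ring_quotient. *)
Definition is_ideal I : Prop :=
  I 0 /\ forall a x y, I x -> I y -> I (a * x + y).

Definition ideal_gen (A : set S) : set S := smallest is_ideal A.

Definition ideal_mul I J : set S :=
  ideal_gen [set z | exists x y, [/\ I x, J y & z = x * y]].

Definition colon I J : set S := [set x | forall y, J y -> I (x * y)].

Definition maximal_ideal (n : set S) : Prop :=
  [/\ is_ideal n, ~ n 1 &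
      forall I, is_ideal I -> n `<=` I -> ~ I 1 -> I = n].

Definition local_ring (n : set S) : Prop :=
  maximal_ideal n /\ forall n', maximal_ideal n' -> n' = n.

Definition artinian : Prop :=
  forall I : nat -> set S, (forall i, is_ideal (I i)) ->
    (forall i, I i.+1 `<=` I i) ->
    exists N, forall i, (N <= i)%N -> I i = I N.

Definition noetherian : Prop :=
  forall I : nat -> set S, (forall i, is_ideal (I i)) ->
    (forall i, I i `<=` I i.+1) ->
    exists N, forall i, (N <= i)%N -> I i = I N.

End Ideals.

Arguments artinian S : clear implicits.
Arguments noetherian S : clear implicits.

Section Modules.
Variable S : comNzRingType.

Definition exact_at (A B C : lmodType S)
    (f : {linear A -> B}) (g : {linear B -> C}) : Prop :=
  range f = [set x | g x = 0].

Definition surjective_map (A B : Type) (f : A -> B) : Prop := range f = setT.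

Definition injective_module (E : lmodType S) : Prop :=
  forall (A B : lmodType S) (i : {linear A -> B}) (f : {linear A -> E}),
    injective i -> exists g : {linear B -> E}, forall x, g (i x) = f x.

Definition projective_module (P : lmodType S) : Prop :=
  forall (A B : lmodType S) (p : {linear A -> B}) (f : {linear P -> B}),
    surjective_map p -> exists g : {linear P -> A}, forall x, p (g x) = f x.

(* An injective resolution 0 -> M -> E_0 -> ... -> E_n -> 0, cut into short
   exact sequences 0 -> M -> E_0 -> C -> 0. *)
Fixpoint injdim_le (n : nat) (M : lmodType S) : Prop :=
  if n is n'.+1 then
    exists (E C : lmodType S) (i : {linear M -> E}) (p : {linear E -> C}),
      [/\ injective_module E, injective i, exact_at i p, surjective_map p
        & injdim_le n' C]
  else injective_module M.

Definition isomorphic (A B : lmodType S) : Prop :=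
  exists f : {linear A -> B}, bijective f.

Definition direct_summand (T M : lmodType S) : Prop :=
  exists N : lmodType S, isomorphic M (T * N)%type.

(* T is isomorphic to S/I. *)
Definition is_quotient_by (I : set S) (T : lmodType S) : Prop :=
  exists q : {linear S^o -> T}, surjective_map q /\ [set x | q x = 0] = I.

(* The submodule M of V can be generated by m elements. *)
Definition generated_by (V : lmodType S) (M : set V) (m : nat) : Prop :=
  exists p : {linear 'rV[S]_m -> V}, range p = M.

Definition finitely_generated (V : lmodType S) : Prop :=
  exists m, generated_by [set: V] m.

Definition min_generators (V : lmodType S) (M : set V) (m : nat) : Prop :=
  generated_by M m /\ forall m', generated_by M m' -> (m <= m')%N.

(* S^b --phi--> S^m --p--> M -> 0 is exact and m = mu(M); vectors are rows,
   and phi acts by right multiplication. *)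
Definition minimal_presentation (V : lmodType S) (M : set V) (m b : nat)
    (phi : 'M[S]_(b, m)) (p : {linear 'rV[S]_m -> V}) : Prop :=
  [/\ min_generators M m, range p = M &
      [set x | p x = 0] = range (fun u : 'rV[S]_b => u *m phi)].

(* For M finitely presented over a local ring, the ideal generated by the
   entries of phi does not depend on the presentation, so the union below is
   this common ideal. *)
Definition Fitt1 (V : lmodType S) (M : set V) : set S :=
  [set x | exists (m b : nat) (phi : 'M[S]_(b, m)) (p : {linear 'rV[S]_m -> V}),
     minimal_presentation M phi p /\
     ideal_gen [set a | exists i j, a = phi i j] x].

(* M' is a second syzygy of M, with finitely generated P_1 and P_2. *)
Definition second_syzygy (M M' : lmodType S) : Prop :=
  exists (P2 P1 : lmodType S) (i : {linear M' -> P2}) (d : {linear P2 -> P1})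
         (e : {linear P1 -> M}),
    [/\ projective_module P1 /\ finitely_generated P1,
        projective_module P2 /\ finitely_generated P2,
        injective i,
        exact_at i d &
        exact_at d e /\ surjective_map e].

End Modules.

(* Gorenstein local ring: noetherian of finite injective dimension over
   itself; locality is a separate hypothesis. *)
Definition gorenstein (S : comNzRingType) : Prop :=
  noetherian S /\ exists n, injdim_le n (S^o : lmodType S).

(* Hom_S(R, S) as an R-module, through (r f)(x) = f (r x). *)
Section CanonicalModule.
Variables (S : comNzRingType) (R : comAlgType S).

Definition canonical_module := {linear R -> S^o}.

Implicit Types f g h : canonical_module.

HB.instance Definition _ := gen_eqMixin canonical_module.
HB.instance Definition _ := gen_choiceMixin canonical_module.

Lemma canonical_module_ext f g : (forall x, f x = g x) -> f = g.
Proof.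
move=> fg; have E : (f : R -> S^o) = g by apply/funext.
case: f g E {fg} => [f [[f1] [f2]]] [g [[g1] [g2]]] /= E; subst g.
by rewrite (Prop_irrelevance f1 g1) (Prop_irrelevance f2 g2).
Qed.

Definition cm_zero : canonical_module := @GRing.null_fun R S^o.
Definition cm_opp f : canonical_module := @GRing.opp_fun R S^o f.
Definition cm_add f g : canonical_module := @GRing.add_fun R S^o f g.

Fact cm_addA : associative cm_add.
Proof. by move=> f g h; apply: canonical_module_ext => x /=; rewrite addrA. Qed.
Fact cm_addC : commutative cm_add.
Proof. by move=> f g; apply: canonical_module_ext => x /=; rewrite addrC. Qed.
Fact cm_add0 : left_id cm_zero cm_add.
Proof. by move=> f; apply: canonical_module_ext => x /=; rewrite add0r. Qed.
Fact cm_addN : left_inverse cm_zero cm_opp cm_add.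
Proof. by move=> f; apply: canonical_module_ext => x /=; rewrite addNr. Qed.

HB.instance Definition _ :=
  GRing.isZmodule.Build canonical_module cm_addA cm_addC cm_add0 cm_addN.

Definition cm_scale_fun (r : R) f (x : R) : S^o := f (r * x).

Fact cm_scale_linear r f : linear (cm_scale_fun r f).
Proof. by move=> a x y; rewrite /cm_scale_fun mulrDr -scalerAr linearP. Qed.

HB.instance Definition _ r f :=
  GRing.isLinear.Build S R S^o _ (cm_scale_fun r f) (cm_scale_linear r f).

Definition cm_scale (r : R) f : canonical_module := cm_scale_fun r f.

Fact cm_scaleA a b f : cm_scale a (cm_scale b f) = cm_scale (a * b) f.
Proof.
by apply: canonical_module_ext => x /=; rewrite /cm_scale_fun /= mulrA [b * a]mulrC.
Qed.
Fact cm_scale1 : left_id 1 cm_scale.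
Proof. by move=> f; apply: canonical_module_ext => x; rewrite /= /cm_scale_fun mul1r. Qed.
Fact cm_scaleDr : right_distributive cm_scale +%R.
Proof. by move=> a f g; apply: canonical_module_ext. Qed.
Fact cm_scaleDl f : {morph cm_scale^~ f : a b / a + b}.
Proof.
move=> a b; apply: canonical_module_ext => x.
by rewrite /= /cm_scale_fun mulrDl linearD.
Qed.

HB.instance Definition _ := GRing.Zmodule_isLmodule.Build R canonical_module
  cm_scaleA cm_scale1 cm_scaleDr cm_scaleDl.

End CanonicalModule.

(* Main.v *)
(* Write I = 0 :_S K. An Artinian local ring of finite injective dimension is
   self-injective, so every ideal J of S satisfies 0 : (0 : J) = J; hence
   omega_R = K, and the hypothesis on the colon ideals says exactly that
   n (I : n) is not contained in n I. Pick w in I : n with n w not contained in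
   n I, and a presentation phi of K with entries generating n; then some entry
   satisfies phi_ij w notin n I. A second syzygy of omega_R over R is
   Z = {v in R^b | v phi = 0}. The element z = w e_i lies in Z and is killed
   by m, but it is not in m Z: any element of m Z has a lift v to S^b with
   all entries of v phi in n I, and, the entries of phi being in n, so
   does every lift. A socle element outside m Z spans a direct summand of Z. *)

From HB Require Import structures.
Require Import Defs.
From mathcomp Require Import all_boot all_algebra.
From mathcomp Require Import ring.
From mathcomp Require Import boolp classical_sets.

Set Implicit Arguments.
Unset Strict Implicit.
Unset Printing Implicit Defensive.

Import GRing.Theory.
Local Open Scope classical_set_scope.
Local Open Scope ring_scope.

(** * Submodules as module types *)

Definition is_submodule (R : comNzRingType) (V : lmodType R) (P : set V) : Prop :=
  P 0 /\ forall a x y, P x -> P y -> P (a *: x + y).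

Section SubmoduleType.
Variables (R : comNzRingType) (V : lmodType R) (P : set V).

Definition submodule_mem (P_sub : is_submodule P) : {pred V} := fun x => `[< P x >].

Lemma submodule_memP (P_sub : is_submodule P) x :
  reflect (P x) (x \in submodule_mem P_sub).
Proof. exact: asboolP. Qed.

Lemma submodule_mem_closed (P_sub : is_submodule P) :
  submod_closed (submodule_mem P_sub).
Proof.
split; first by apply/submodule_memP; case: P_sub.
move=> a x y /submodule_memP Px /submodule_memP Py.
by apply/submodule_memP; apply: P_sub.2.
Qed.

Record submodule (P_sub : is_submodule P) := Submodule {
  submodule_val : V; _ : submodule_val \in submodule_mem P_sub }.

Variable P_sub : is_submodule P.
HB.instance Definition _ := [isSub for @submodule_val P_sub].
HB.instance Definition _ := [Choice of submodule P_sub by <:].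
HB.instance Definition _ := GRing.SubChoice_isSubLmodule.Build R V
  (submodule_mem P_sub) (submodule P_sub) (submodule_mem_closed P_sub).

Lemma submodule_valP (x : submodule P_sub) : P (val x).
Proof. exact/submodule_memP/valP. Qed.

Lemma submodule_valB (x y : submodule P_sub) : val (x - y) = val x - val y.
Proof. exact: (linearB (val : {linear submodule P_sub -> V})). Qed.

Definition to_submodule x (Px : P x) : submodule P_sub :=
  Submodule (introT (submodule_memP P_sub x) Px).
End SubmoduleType.

(** Without an extremal element, choice builds a [rel]-chain in [P] that moves at every step.
    Leaving [rel] general covers ascending and descending chains alike. *)
Lemma chain_condition_extremal (T : Type) (rel : T -> T -> Prop) (P : set T) (x0 : T) :
    (forall u : nat -> T, (forall i, P (u i)) -> (forall i, rel (u i) (u i.+1)) ->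
       exists N, u N.+1 = u N) ->
  P x0 -> exists x, P x /\ forall y, P y -> rel x y -> y = x.
Proof.
move=> stop Px0; apply: contrapT => noext.
have next (x : {x | P x}) : {y : {y | P y} | rel (sval x) (sval y) /\ sval y <> sval x}.
  case: x => x Px /=; apply/cid; apply: contrapT => nox; apply: noext.
  exists x; split=> // y Py xy; apply: contrapT => nyx.
  by apply: nox; exists (exist _ y Py).
pose u := fix u i := if i is i'.+1 then sval (next (u i')) else exist _ x0 Px0.
have [||N] := stop (fun i => sval (u i)).
- by move=> i; apply: svalP.
- by move=> i /=; have [] := svalP (next (u i)).
- by move=> /=; have [] := svalP (next (u N)).
Qed.

(** * Ideals, units and socles in local rings *)

Section Ideals.
Variable S : comNzRingType.
Implicit Types (I J : set S).

Lemma idealD I x y : is_ideal I -> I x -> I y -> I (x + y).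
Proof. by case=> _ h Ix Iy; rewrite -[x]mul1r; apply: h. Qed.

Lemma idealM I a x : is_ideal I -> I x -> I (a * x).
Proof. by case=> I0 h Ix; rewrite -[a * x]addr0; apply: h. Qed.

Lemma idealB I x y : is_ideal I -> I x -> I y -> I (x - y).
Proof. by move=> hI Ix Iy; rewrite -mulN1r; apply: idealD => //; apply: idealM. Qed.

Lemma ideal_sum I (T : Type) (r : seq T) (P : pred T) (F : T -> S) :
  is_ideal I -> (forall i, P i -> I (F i)) -> I (\sum_(i <- r | P i) F i).
Proof.
by move=> hI hF; apply: (big_ind I) => //; [case: hI | move=> *; apply: idealD].
Qed.

Lemma ideal_gen_is_ideal (A : set S) : is_ideal (ideal_gen A).
Proof.
split; first by move=> I [[]].
by move=> a x y hx hy I hI; apply: hI.1.2; [apply: hx | apply: hy].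
Qed.

Lemma ideal_gen_sub (A I : set S) : is_ideal I -> A `<=` I -> ideal_gen A `<=` I.
Proof. by move=> hI AI x; apply. Qed.

Lemma sub_ideal_gen (A : set S) : A `<=` ideal_gen A.
Proof. by move=> x Ax I [_]; apply. Qed.

Lemma ideal_mul_mem I J x y : I x -> J y -> ideal_mul I J (x * y).
Proof. by move=> Ix Jy; apply: sub_ideal_gen; exists x, y. Qed.

Lemma is_ideal_colon I J : is_ideal I -> is_ideal (colon I J).
Proof.
move=> hI; split; first by move=> y _; rewrite mul0r; case: hI.
move=> a x y hx hy z Jz; rewrite mulrDl -mulrA.
by apply: idealD => //; [apply: idealM => //; apply: hx | apply: hy].
Qed.

Lemma is_ideal0 : is_ideal [set 0 : S].
Proof. by split=> // a x y /= -> ->; rewrite mulr0 add0r. Qed.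

Definition adjoin J x : set S := [set y | exists a j, J j /\ y = a * x + j].

Lemma is_ideal_adjoin J x : is_ideal J -> is_ideal (adjoin J x).
Proof.
move=> hJ; split.
  by exists 0, 0; rewrite mul0r addr0; split=> //; case: hJ.
move=> a _ _ [b [j [Jj ->]]] [c [k [Jk ->]]].
exists (a * b + c), (a * j + k); split; first exact: hJ.2.
by rewrite mulrDr mulrDl mulrA addrACA.
Qed.

Lemma sub_adjoin J x : J `<=` adjoin J x.
Proof. by move=> j Jj; exists 0, j; rewrite mul0r add0r. Qed.

Lemma mem_adjoin J x : is_ideal J -> adjoin J x x.
Proof. by case=> J0 _; exists 1, 0; rewrite mul1r addr0. Qed.

Lemma noetherian_maximal (P : set (set S)) J :
    noetherian S -> (forall I, P I -> is_ideal I) -> P J ->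
  exists I, P I /\ forall I', P I' -> I `<=` I' -> I' = I.
Proof.
move=> noeS hP; apply: chain_condition_extremal => u Pu incr.
have [|N hN] := noeS u _ incr; first by move=> i; apply/hP.
by exists N; apply: hN.
Qed.

Lemma artinian_minimal (P : set (set S)) J :
    artinian S -> (forall I, P I -> is_ideal I) -> P J ->
  exists I, P I /\ forall I', P I' -> I' `<=` I -> I' = I.
Proof.
move=> artS hP; apply: (@chain_condition_extremal _ (fun I I' => I' `<=` I)) => u Pu decr.
have [|N hN] := artS u _ decr; first by move=> i; apply/hP.
by exists N; apply: hN.
Qed.

Section Local.
Variable n : set S.
Hypotheses (n_local : local_ring n) (S_noeth : noetherian S).

Lemma local_is_ideal : is_ideal n. Proof. by have [[]] := n_local. Qed.
Lemma local_proper : ~ n 1. Proof. by have [[]] := n_local. Qed.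

(** If [u] is not a unit, [Su] is proper; an ideal maximal among the proper ideals containing [u] is
    a maximal ideal, hence equals [n]. *)
Lemma local_unit u : ~ n u -> exists v, v * u = 1.
Proof.
move=> nu; apply: contrapT => nv; apply: nu.
pose P : set (set S) := [set I | [/\ is_ideal I, I u & ~ I 1]].
have P0 : P (adjoin [set 0] u).
  split; [exact/is_ideal_adjoin/is_ideal0 | exact/mem_adjoin/is_ideal0 |].
  by case=> a [j [/= ->]]; rewrite addr0 => e; apply: nv; exists a.
have [|I [[hI Iu I1] Imax]] := noetherian_maximal S_noeth _ P0; first by move=> I [].
have -> // : n = I.
apply/esym; apply: n_local.2; split=> // J hJ IJ J1.
by apply: Imax => //; split=> //; apply: IJ.
Qed.

(** Any [x] outside [J] in an ideal [I] minimal among those strictly containing [J] will do. If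
    [a * x] were outside [J], minimality would give [J + Sax = I], so [x = b * a * x + j]; as
    [1 - b * a] is a unit, [x] would lie in [J]. *)
Lemma cyclic_ideal_socle J : artinian S -> is_ideal J -> ~ J 1 ->
  exists x, ~ J x /\ forall a, n a -> J (a * x).
Proof.
move=> S_art hJ J1; have hn := local_is_ideal.
pose P : set (set S) := [set I | [/\ is_ideal I, J `<=` I & I <> J]].
have PT : P setT by split=> // JT; apply: J1; rewrite -JT.
have [|I [[hI JI nIJ] Imin]] := artinian_minimal S_art _ PT; first by move=> I [].
have [x [Ix nJx]] : exists x, I x /\ ~ J x.
  apply: contrapT => hx; apply: nIJ; apply/seteqP; split=> // x Ix.
  by apply: contrapT => nJx; apply: hx; exists x.
exists x; split=> // a na; apply: contrapT => nJax.
have : adjoin J (a * x) x.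
  rewrite (Imin (adjoin J (a * x))) //; last first.
    move=> _ [b [j [Jj ->]]]; apply: idealD => //; last exact: JI.
    by apply: idealM => //; apply: idealM.
  split; [exact: is_ideal_adjoin | exact: sub_adjoin |].
  by move=> e; apply: nJax; rewrite -e; apply: mem_adjoin.
case=> b [j [Jj xE]]; apply: nJx.
have [|v vE] := @local_unit (1 - b * a).
  move=> h; apply: local_proper; rewrite -[1](subrK (b * a)).
  by apply: idealD => //; apply: idealM.
rewrite -[x]mul1r -vE -mulrA mulrBl mul1r -mulrA.
by rewrite {1}xE [_ + j]addrC addrK; apply: idealM.
Qed.

End Local.
End Ideals.

(** * Self-injectivity of Artinian Gorenstein local rings *)

Section SelfInjective.
Variable S : comNzRingType.

(** Baer's criterion. A linear map on [J] is encoded as a function on all of [S] whose values matter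
    only on [J]. *)
Definition baer_injective (M : lmodType S) : Prop :=
  forall (J : set S) (f : S -> M), is_ideal J ->
    (forall a x y, J x -> J y -> f (a * x + y) = a *: f x + f y) ->
  exists m, forall x, J x -> f x = x *: m.

Lemma injective_baer (M : lmodType S) : injective_module M -> baer_injective M.
Proof.
move=> injM J f hJ flin.
have hJ' : is_submodule (J : set S^o) by [].
pose f' (x : submodule hJ') : M := f (val x).
have f'lin : linear f'.
  by move=> a x y; rewrite /f' linearP; apply: flin; apply: submodule_valP.
pose F : {linear submodule hJ' -> M} :=
  HB.pack f' (GRing.isLinear.Build _ _ _ _ f' f'lin).
have [|g gE] := injM _ _ (val : {linear submodule hJ' -> S^o}) F; first exact: val_inj.
exists (g 1) => x Jx.
have := gE (to_submodule hJ' Jx); rewrite /F /f' /= => <-.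
by rewrite -linearZ /= /GRing.scale /= mulr1.
Qed.

(** The hypothesis on [m] makes [a * x + j |-> a *: m] well defined on [J + Sx]; the element
    representing this map is [e]. *)
Lemma baer_extend (M : lmodType S) (J : set S) (x : S) (m : M) :
    baer_injective M -> is_ideal J -> (forall a, J (a * x) -> a *: m = 0) ->
  exists e, x *: e = m /\ forall y, J y -> y *: e = 0.
Proof.
move=> injM hJ hm.
(* A chosen coefficient of [x] in [y] modulo [J]; the default [0] is taken only outside [J + Sx]. *)
pose g y := xget 0 [set a | J (a * x - y)].
have gP y : adjoin J x y -> J (g y * x - y).
  move=> [a [j [Jj ->]]]; rewrite /g; case: xgetP => [b _ //|/(_ a) /=].
  rewrite opprD addrA subrr sub0r -mulN1r => h; exfalso; apply: h; exact: idealM.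
have gE y m' : adjoin J x y -> J (m' * x - y) -> g y *: m = m' *: m.
  move=> /gP Jg Jm; apply/eqP; rewrite -subr_eq0 -scalerBl; apply/eqP/hm.
  have -> : (g y - m') * x = (g y * x - y) - (m' * x - y) by ring.
  exact: idealB.
have hadj := is_ideal_adjoin x hJ.
have [|e eE] := injM (adjoin J x) (fun y => g y *: m) hadj.
  move=> a y z hy hz; rewrite scalerA -scalerDl; apply: gE; first exact: hadj.2.
  have -> : (a * g y + g z) * x - (a * y + z) = a * (g y * x - y) + (g z * x - z) by ring.
  by apply: hJ.2; apply: gP.
exists e; split=> [|y Jy].
  rewrite -eE; last exact: mem_adjoin.
  rewrite (@gE _ 1) ?scale1r // ?mul1r ?subrr; last by case: hJ.
  exact: mem_adjoin.
rewrite -eE; last exact: sub_adjoin.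
rewrite (@gE _ 0) ?scale0r // ?mul0r ?sub0r; first exact: sub_adjoin.
by rewrite -mulN1r; apply: idealM.
Qed.

Variable n : set S.
Hypotheses (n_local : local_ring n) (S_noeth : noetherian S) (S_art : artinian S).

(* [S/J] is filtered by copies of the residue field, for which the lifting
   extends along the embedding of that field as the socle of [S]. *)
Lemma lift_annihilated (E C : lmodType S) (p : {linear E -> C}) (J : set S) :
    baer_injective E -> baer_injective C -> surjective_map p -> is_ideal J ->
  forall c, (forall x, J x -> x *: c = 0) ->
  exists e, p e = c /\ forall x, J x -> x *: e = 0.
Proof.
move=> injE injC surj_p hJ.
have hn := local_is_ideal n_local.
have pK c : exists e, p e = c.
  by have : setT c by []; rewrite -surj_p => -[e _ <-]; exists e.
pose good (I : set S) := forall c, (forall x, I x -> x *: c = 0) ->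
  exists e, p e = c /\ forall x, I x -> x *: e = 0.
have good_n : good n.
  move=> c hc.
  have [|s [s0 ns]] := cyclic_ideal_socle n_local S_noeth S_art (is_ideal0 S).
    by move=> /= /eqP; rewrite oner_eq0.
  (* Write [c = s *: c'] with [s] in the socle of [S]: for any lift [e] of [c'], [s *: e] lifts [c]
     and is killed by [n]. *)
  have [|c' [sc' _]] := baer_extend injC (x := s) (m := c) (is_ideal0 S).
    move=> a /= as0; apply: hc; apply: contrapT => /(local_unit n_local S_noeth) [v vE].
    by apply: s0; rewrite /= -[s]mul1r -vE -mulrA as0 mulr0.
  have [e eE] := pK c'; exists (s *: e); split; first by rewrite linearZ /= eE.
  by move=> x nx; rewrite scalerA ns // scale0r.
(* Noetherian induction: [I] is maximal among the ideals for which lifting fails. *)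
apply: contrapT => badJ.
have [||I [[hI badI] Imax]] :=
  @noetherian_maximal S [set I | is_ideal I /\ ~ good I] J S_noeth.
- by move=> I [].
- by split.
have I1 : ~ I 1.
  move=> I1; apply: badI => c hc; have [e eE] := pK c.
  have c0 : c = 0 by rewrite -[c]scale1r hc.
  by exists 0; rewrite linear0 c0; split=> // x _; rewrite scaler0.
have [x [nIx Ix]] := cyclic_ideal_socle n_local S_noeth S_art hI I1.
have good_adj : good (adjoin I x).
  apply: contrapT => bad; apply: nIx.
  rewrite -(Imax (adjoin I x)); first exact: mem_adjoin.
    by split=> //; apply: is_ideal_adjoin.
  exact: sub_adjoin.
apply: badI => c hc.
(* First correct [c] on [x]: lift [x *: c] to [e1] killed by [n], and write [e1 = x *: e2] with [I]
   killing [e2]. Then [c - p e2] is killed by [I + Sx], where lifting is possible by maximality of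
   [I]. *)
have [|e1 [pe1 ne1]] := good_n (x *: c).
  by move=> a na; rewrite scalerA; apply/hc/Ix.
have [|e2 [e2x e2I]] := baer_extend injE (x := x) (m := e1) hI.
  move=> a Iax; apply: ne1; apply: contrapT => /(local_unit n_local S_noeth) [v vE].
  by apply: nIx; rewrite -[x]mul1r -vE -mulrA; apply: idealM.
have [|e3 [pe3 e3I]] := good_adj (c - p e2).
  move=> _ [a [j [Ij ->]]].
  have xE : x *: (c - p e2) = 0 by rewrite scalerBr -linearZ /= e2x pe1 subrr.
  have jE : j *: (c - p e2) = 0 by rewrite scalerBr -linearZ /= e2I // linear0 hc // subrr.
  by rewrite scalerDl -scalerA xE jE scaler0 addr0.
exists (e2 + e3); split; first by rewrite linearD /= pe3 addrC subrK.
by move=> y Iy; rewrite scalerDr e2I // e3I ?addr0 //; apply: sub_adjoin.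
Qed.

(** Induction along the resolution. Inside [E], a map [J -> M] is multiplication by some [e], and
    [J] kills [p e]. Subtracting a lift [e'] of [p e] killed by [J] moves [e] into [M] without
    changing the map. *)
Lemma injdim_baer k (M : lmodType S) : injdim_le k M -> baer_injective M.
Proof.
elim: k M => [|k IHk] M /=; first exact: injective_baer.
case=> E [C [i [p [/injective_baer injE inj_i ex_ip surj_p /IHk injC]]]].
move=> J f hJ flin.
have [a x y Jx Jy|e eE] := injE J (fun x => i (f x)) hJ.
  by rewrite flin // linearP.
have [|e' [pe' e'J]] := lift_annihilated injE injC surj_p hJ (c := p e).
  move=> x Jx; rewrite -linearZ /= -eE //.
  have : range i (i (f x)) by exists (f x).
  by rewrite ex_ip.
have : [set x | p x = 0] (e - e') by rewrite /= linearB /= pe' subrr.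
rewrite -ex_ip => -[m _ mE]; exists m => x Jx.
by apply: inj_i; rewrite linearZ /= mE scalerBr e'J // subr0 eE.
Qed.

(* For [x] outside [J], mapping [x] to a socle element defines a linear form on
   [J + Sx] vanishing on [J]; by injectivity it is multiplication by some [s]. *)
Lemma double_annihilator (J : set S) : gorenstein S -> is_ideal J ->
  colon [set 0] (colon [set 0] J) `<=` J.
Proof.
move=> [_ [k /injdim_baer injS]] hJ x xJ; apply: contrapT => nJx.
have [|s [s0 ns]] := cyclic_ideal_socle n_local S_noeth S_art (is_ideal0 S).
  by move=> /= /eqP; rewrite oner_eq0.
have [|t [xt Jt]] := baer_extend injS (x := x) (m := s : S^o) hJ.
  move=> a Jax; apply: ns; apply: contrapT => /(local_unit n_local S_noeth) [v vE].
  by apply: nJx; rewrite -[x]mul1r -vE -mulrA; apply: idealM.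
apply: s0; rewrite -xt; apply: xJ => y Jy.
by rewrite mulrC; apply: Jt.
Qed.

End SelfInjective.

(** * Splitting off a socle element *)

Section SocleSummand.
Variables (R : comNzRingType) (V : lmodType R).
Implicit Types N Z W : set V.

Lemma submoduleD N x y : is_submodule N -> N x -> N y -> N (x + y).
Proof. by case=> _ h Nx Ny; rewrite -[x]scale1r; apply: h. Qed.

Lemma submoduleZ N a x : is_submodule N -> N x -> N (a *: x).
Proof. by case=> N0 h Nx; rewrite -[_ *: x]addr0; apply: h. Qed.

(* A socle element [z] of [Z] outside [mZ] spans a direct summand: a submodule
   containing [mZ] and maximal among those avoiding [z] is a complement. *)
Lemma socle_complement (m : set R) Z W z :
    (forall r, ~ m r -> exists v, v * r = 1) ->
    is_submodule Z -> Z z -> is_submodule W -> W `<=` Z ->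
    (forall r y, m r -> Z y -> W (r *: y)) -> ~ W z ->
  exists N, [/\ is_submodule N, N `<=` Z, ~ N z
              & forall y, Z y -> exists r, N (y - r *: z)].
Proof.
move=> m_unit hZ Zz hW WZ mZ nWz.
pose good N := [/\ is_submodule N, W `<=` N, N `<=` Z & ~ N z].
have [F Fgood Ftot|N [NP Nmax]] := @Zorn_bigcup V [set N | N = set0 \/ good N].
  have [[N0 [FN0 goodN0]]|nogood] := EM (exists N, F N /\ good N); last first.
    left; apply/seteqP; split=> // x [N FN Nx].
    case: (Fgood _ FN) => [N0|goodN]; first by move: Nx; rewrite N0.
    by exfalso; apply: nogood; exists N.
  have mem N x : F N -> N x -> good N.
    by move=> FN Nx; case: (Fgood _ FN) => // e; move: Nx; rewrite e.
  case: goodN0 => hN0 WN0 _ _; right; split.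
  - split; first by exists N0 => //; case: hN0.
    move=> a x y [N1 FN1 Nx] [N2 FN2 Ny].
    have [[h1 _ _ _] [h2 _ _ _]] := (mem _ _ FN1 Nx, mem _ _ FN2 Ny).
    have [N12|N21] := Ftot _ _ FN1 FN2.
      by exists N2 => //; apply: h2.2 => //; apply: N12.
    by exists N1 => //; apply: h1.2 => //; apply: N21.
  - by move=> x Wx; exists N0 => //; apply: WN0.
  - by move=> x [N FN Nx]; have [_ _ NZ _] := mem _ _ FN Nx; apply: NZ.
  - by move=> [N FN Nz]; have [_ _ _] := mem _ _ FN Nz; apply.
have [hN WN NZ nNz] : good N.
  case: NP => // N0; exfalso; apply: (Nmax W); last by right; split.
  by rewrite N0; split=> // h; have /h := hW.1.
exists N; split=> // y Zy; have [Ny|nNy] := EM (N y).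
  by exists 0; rewrite scale0r subr0.
(* By maximality [N + Ry] contains [z], so [z = r *: y + u] with [u] in [N]. Here [r] is a unit,
   since otherwise [r *: y] lies in [W] and [z] in [N]. *)
pose N' : set V := [set x | exists r u, N u /\ x = r *: y + u].
have N'P r u : N u -> N' (r *: y + u) by move=> Nu; exists r, u.
have hN' : is_submodule N'.
  split; first by exists 0, 0; rewrite scale0r addr0; split=> //; case: hN.
  move=> a _ _ [r [u [Nu ->]]] [s [v [Nv ->]]].
  rewrite scalerDr scalerA addrACA -scalerDl; apply: N'P; exact: hN.2.
have NN' : N `<=` N' by move=> u Nu; rewrite -[u]add0r -(scale0r y); apply: N'P.
have N'y : N' y by rewrite -[y]addr0 -{1}[y]scale1r; apply: N'P; case: hN.
have : N' z.
  apply: contrapT => nN'z; apply: (Nmax N').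
    by split=> // N'N; apply: nNy; apply: N'N.
  right; split=> //; first by move=> u /WN /NN'.
  by move=> _ [r [u [Nu ->]]]; apply: hZ.2 => //; apply: NZ.
case=> r [u [Nu zE]].
have [|v vr] := m_unit r.
  by move=> mr; apply: nNz; rewrite zE; apply: submoduleD => //; apply/WN/mZ.
exists v; have -> : y - v *: z = - v *: u.
  by rewrite zE scalerDr scalerA vr scale1r opprD addrA subrr sub0r scaleNr.
exact: submoduleZ.
Qed.

End SocleSummand.

(** * Free modules of row vectors *)

Section FreeModules.
Variable R : comNzRingType.

Lemma row_module_projective k : projective_module ('rV[R]_k).
Proof.
move=> A B p f surj_p.
have pK b : exists a, p a = b.
  by have : setT b by []; rewrite -surj_p => -[a _ <-]; exists a.
pose a i := sval (cid (pK (f (delta_mx 0 i)))).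
pose g (u : 'rV[R]_k) : A := \sum_i u 0 i *: a i.
have g_lin : linear g.
  move=> c u v; rewrite /g scaler_sumr -big_split /=; apply: eq_bigr => i _.
  by rewrite !mxE scalerDl scalerA.
pose G : {linear 'rV[R]_k -> A} := HB.pack g (GRing.isLinear.Build _ _ _ _ g g_lin).
exists G => u; rewrite /G /=.
rewrite /g linear_sum {2}[u]row_sum_delta linear_sum; apply: eq_bigr => i _.
by rewrite !linearZ /= (svalP (cid (pK (f (delta_mx 0 i))))).
Qed.

Lemma row_module_fg k : finitely_generated ('rV[R]_k).
Proof.
exists k, idfun; apply/seteqP; split=> // x _; by exists x.
Qed.

End FreeModules.

(** * The quotient ring [R = S/I] *)

Section QuotientRing.
Variables (S : comNzRingType) (n : set S) (R : comAlgType S) (m : set R) (K : set S).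
Hypotheses (S_local : local_ring n) (S_noeth : noetherian S) (R_local : local_ring m).
Hypothesis R_surj : surjective_map (fun s : S => s%:A : R).
Hypothesis R_ker : [set s : S | s%:A = 0 :> R] = colon [set 0] K.

Local Notation I := (colon [set 0] K).

(* Kept abstract: the coercion of [in_alg R] to functions unfolds under [simpl]. *)
Variable toR : {rmorphism S -> R}.
Hypothesis toRE : forall s, toR s = s%:A.

Definition lift (r : R) : S := xget 0 [set s | toR s = r].

Lemma liftK r : toR (lift r) = r.
Proof.
rewrite /lift; case: xgetP => // nolift.
have : setT r by []; rewrite -R_surj => -[s _ sr].
by exfalso; apply: (nolift s); rewrite /= toRE.
Qed.

Lemma toR_eq0 s : toR s = 0 <-> I s.
Proof. by rewrite -R_ker toRE. Qed.

Lemma toR_eq s t : toR s = toR t -> I (s - t).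
Proof. by move=> st; apply/toR_eq0; rewrite rmorphB st subrr. Qed.

(** The preimage of [m] is a maximal ideal of [S], hence [n]: a proper ideal [J] above it contains
    the kernel of [toR], so its image is a proper ideal containing [m]. *)
Lemma maximal_ideal_toR s : m (toR s) <-> n s.
Proof.
suff -> : n = [set s | m (toR s)] by [].
have [[hm m1 m_max] _] := R_local.
apply/esym; apply: S_local.2; split.
- split; first by rewrite /= rmorph0; case: hm.
  by move=> a x y mx my; rewrite /= rmorphD rmorphM; apply: hm.2.
- by rewrite /= rmorph1.
move=> J hJ mJ J1; apply/seteqP; split=> // x Jx /=.
rewrite -(m_max [set r | exists s, J s /\ toR s = r]); first by exists x.
- split; first by exists 0; rewrite rmorph0; split=> //; case: hJ.
  move=> a _ _ [y [Jy <-]] [z [Jz <-]]; exists (lift a * y + z).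
  by rewrite rmorphD rmorphM /= liftK; split=> //; apply: hJ.2.
- by move=> r mr; exists (lift r); rewrite liftK; split=> //; apply: mJ; rewrite /= liftK.
case=> t [Jt t1]; apply: J1.
have : J (t - 1) by apply: mJ; rewrite /= rmorphB rmorph1 t1 subrr; case: hm.
by move=> /(idealB hJ Jt); rewrite subKr.
Qed.

Lemma quotient_unit r : ~ m r -> exists v, v * r = 1.
Proof.
rewrite -[r]liftK maximal_ideal_toR => /(local_unit S_local S_noeth) [v vE].
by exists (toR v); rewrite -rmorphM vE rmorph1.
Qed.

Lemma map_liftK k l (u : 'M[R]_(k, l)) : map_mx toR (map_mx lift u) = u.
Proof. by apply/matrixP => i j; rewrite !mxE liftK. Qed.

(** * Presentation of the canonical module over [R] and its second syzygy *)

Section Syzygy.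
Variables (mu b : nat) (phi : 'M[S]_(b, mu)) (p : {linear 'rV[S]_mu -> S^o}).
Hypothesis K_double : colon [set 0] (colon [set 0] K) `<=` K.
Hypothesis p_range : range p = (K : set S^o).
Hypothesis p_ker : [set x | p x = 0] = range (fun u : 'rV[S]_b => u *m phi).

(** The entries of [u - v] lie in [I], which kills [K], and [p] takes its values in [K]. *)
Lemma cover_eq (u v : 'rV[S]_mu) : map_mx toR u = map_mx toR v -> p u = p v.
Proof.
move=> uv; apply/eqP; rewrite -subr_eq0 -linearB /= [u - v]row_sum_delta linear_sum.
apply/eqP; apply: big1 => i _; rewrite linearZ /=.
have /toR_eq : toR (u 0 i) = toR (v 0 i) by have /rowP/(_ i) := uv; rewrite !mxE.
by move=> Iuv; rewrite !mxE; apply: Iuv; rewrite -p_range; exists (delta_mx 0 i).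
Qed.

(** Evaluation at [1] identifies the canonical module with [K]; under it, [u |-> cover_fun u] is [p]
    reduced modulo [I]. *)
Definition cover_fun (u : 'rV[R]_mu) (r : R) : S^o := p (map_mx lift (r *: u)).

Lemma cover_fun_lift u v r :
  map_mx toR v = r *: u -> cover_fun u r = p v.
Proof. by move=> vE; apply: cover_eq; rewrite map_liftK. Qed.

Lemma cover_fun_linear u : linear (cover_fun u).
Proof.
move=> a r s; rewrite (@cover_fun_lift _ (a *: map_mx lift (r *: u) + map_mx lift (s *: u))).
  by rewrite linearP.
by rewrite map_mxD map_mxZ !map_liftK scalerDl scalerA toRE mulr_algl.
Qed.

HB.instance Definition _ u :=
  GRing.isLinear.Build S R S^o _ (cover_fun u) (@cover_fun_linear u).

Definition cover (u : 'rV[R]_mu) : canonical_module R := cover_fun u.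

Lemma cover_linear : linear cover.
Proof.
move=> a u v; apply: canonical_module_ext => r.
rewrite /= /cm_scale_fun /=.
rewrite (@cover_fun_lift _ (map_mx lift (a * r *: u) + map_mx lift (r *: v))).
  by rewrite linearD.
by rewrite map_mxD !map_liftK scalerDr scalerA mulrC.
Qed.

HB.instance Definition _ := GRing.isLinear.Build R _ _ _ cover cover_linear.

(** For [f : R -> S] linear, [I] kills [f 1], so [f 1] lies in [0 : (0 : K)], hence in [K], and is a
    value of [p]. *)
Lemma cover_surj : surjective_map cover.
Proof.
apply/seteqP; split=> // f _.
have : K (f 1).
  apply: K_double => s /toR_eq0 s0 /=.
  have -> : f 1 * s = f (s *: 1) by rewrite linearZ /= mulrC.
  by rewrite -toRE s0 linear0.
rewrite -p_range => -[v _ vE]; exists (map_mx toR v) => //.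
apply: canonical_module_ext => r; rewrite /=.
rewrite (@cover_fun_lift _ (lift r *: v)).
  rewrite linearZ /= vE -linearZ /=; congr (f _); rewrite -toRE; exact: liftK.
by rewrite map_mxZ /= liftK.
Qed.

Definition relations (y : 'rV[R]_b) : 'rV[R]_mu := y *m map_mx toR phi.
Lemma relations_linear : linear relations.
Proof. by move=> a x y; rewrite /relations mulmxDl scalemxAl. Qed.
HB.instance Definition _ := GRing.isLinear.Build R _ _ _ relations relations_linear.

(** Passing to [R] creates no new relations: evaluating [cover u = 0] at [1] shows that a lift of
    [u] is already in the kernel of [p]. *)
Lemma cover_exact : exact_at relations cover.
Proof.
apply/seteqP; split=> u /=.
  case=> y _ <-; apply: canonical_module_ext => r /=.
  rewrite (@cover_fun_lift _ (map_mx lift (r *: y) *m phi)).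
    suff : [set x | p x = 0] (map_mx lift (r *: y) *m phi) by [].
    by rewrite p_ker; exists (map_mx lift (r *: y)).
  by rewrite map_mxM map_liftK /relations scalemxAl.
move=> /(congr1 (fun f : canonical_module R => f 1)) /= u0.
have : [set x | p x = 0] (map_mx lift u).
  by rewrite /= -[RHS]u0; apply/esym; apply: cover_fun_lift; rewrite map_liftK scale1r.
rewrite p_ker => -[y _ yE]; exists (map_mx toR y) => //.
by rewrite /relations -map_mxM yE map_liftK.
Qed.

Hypothesis phi_max : forall i j, n (phi i j).

Lemma second_syzygy_summand w i j :
    (forall a, n a -> I (a * w)) -> ~ ideal_mul n I (phi i j * w) ->
  exists M' T : lmodType R,
    [/\ second_syzygy (canonical_module R) M',
        is_quotient_by m T
      & direct_summand T M'].
Proof.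
move=> Iw nwij; have hnI : is_ideal (ideal_mul n I) by apply: ideal_gen_is_ideal.
have hI : is_ideal I by apply/is_ideal_colon/is_ideal0.
pose Z : set 'rV[R]_b := [set y | relations y = 0].
(* [W] stands in for [mZ]: it contains [mZ], and membership is tested on lifts to [S]. *)
pose W0 : set 'rV[R]_b := [set y | exists v, y = map_mx toR v /\
  forall l, ideal_mul n I ((v *m phi) 0 l)].
pose W := W0 `&` Z.
pose z := map_mx toR (w *: delta_mx 0 i) : 'rV[R]_b.
have hZ : is_submodule Z.
  split; first by rewrite /Z /= linear0.
  by move=> a x y /= x0 y0; rewrite /Z /= relations_linear x0 y0 scaler0 addr0.
have hW0 : is_submodule W0.
  split; first by exists 0; rewrite map_mx0; split=> // l; rewrite mul0mx mxE; case: hnI.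
  move=> a _ _ [u [-> hu]] [v [-> hv]]; exists (lift a *: u + v).
  rewrite map_mxD map_mxZ /= liftK; split=> // l.
  by rewrite mulmxDl -scalemxAl !mxE; apply: hnI.2; have := (hu l, hv l); rewrite !mxE => -[].
have hW : is_submodule W.
  split; first by split; [case: hW0 | case: hZ].
  by move=> a x y [? ?] [? ?]; split; [apply: hW0.2 | apply: hZ.2].
have mZW r y : m r -> Z y -> W (r *: y).
  move=> mr Zy; split; last exact: submoduleZ.
  exists (lift r *: map_mx lift y); rewrite map_mxZ /= liftK map_liftK; split=> // l.
  rewrite -scalemxAl mxE; apply: ideal_mul_mem.
    by apply/maximal_ideal_toR; rewrite liftK.
  apply/toR_eq0; have : relations y = 0 by [].
  rewrite /relations -{1}[y]map_liftK -map_mxM => /rowP/(_ l); by rewrite !mxE.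
have Zz : Z z.
  apply/rowP => l; rewrite /relations /z -map_mxM !mxE; apply/toR_eq0.
  apply: ideal_sum => // k _; rewrite !mxE eqxx /= mulrC; case: (k == i).
    by rewrite mulr1; apply: Iw.
  by rewrite !mulr0; case: hI.
have nWz : ~ W z.
  move=> [[v [/rowP zv hv]] _]; apply: nwij.
  have -> : phi i j * w = ((w *: delta_mx 0 i : 'rV_b) *m phi) 0 j.
    by rewrite -scalemxAl -rowE !mxE mulrC.
  (* The two lifts of [z] differ by a vector over [I], whose product with [phi] has entries in
     [n I]. *)
  rewrite -[w *: _](subrK v) mulmxDl mxE; apply: (idealD hnI) => //.
  rewrite mxE; apply: (ideal_sum _ hnI) => // k _; rewrite mulrC.
  apply: ideal_mul_mem => //; apply/toR_eq0; have := zv k.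
  by rewrite !mxE rmorphB => /= ->; rewrite subrr.
have WZ : W `<=` Z by move=> x [].
have [N [hN NZ nNz cover_Z]] := socle_complement quotient_unit hZ Zz hW WZ mZW nWz.
have mz r : m r -> r *: z = 0.
  rewrite -[r]liftK => /maximal_ideal_toR nr; rewrite /z -map_mxZ scalerA map_mxZ /=.
  have /toR_eq0 /= -> := Iw _ nr; exact: scale0r.
have Nz_m r : N (r *: z) -> m r.
  move=> Nrz; apply: contrapT => /quotient_unit [v vr]; apply: nNz.
  by rewrite -[z]scale1r -vr -scalerA; apply: submoduleZ.
pose T0 : set 'rV[R]_b := [set y | exists r, y = r *: z].
have hT0 : is_submodule T0.
  split; first by exists 0; rewrite scale0r.
  by move=> a _ _ [r ->] [s ->]; exists (a * r + s); rewrite scalerDl scalerA.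
have T0z r : T0 (r *: z) by exists r.
(* The syzygy is taken to be the external sum of [Rz] and [N], embedded onto [Z] by addition, so its
   splitting is the identity. *)
pose inc (x : submodule hT0 * submodule hN) : 'rV[R]_b := val x.1 + val x.2.
have inc_lin : linear inc.
  move=> a x y; rewrite /inc.
  rewrite [val (_ + _).1](linearP (val : {linear submodule hT0 -> _})).
  rewrite [val (_ + _).2](linearP (val : {linear submodule hN -> _})) /=.
  by rewrite scalerDr addrACA.
pose Inc : {linear (submodule hT0 * submodule hN)%type -> 'rV[R]_b} :=
  HB.pack inc (GRing.isLinear.Build _ _ _ _ inc inc_lin).
pose q r : submodule hT0 := to_submodule hT0 (T0z r).
have q_lin : linear (q : R^o -> _).
  by move=> a r s; apply: val_inj; rewrite linearP /= scalerDl scalerA.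
pose Q : {linear R^o -> submodule hT0} :=
  HB.pack (q : R^o -> _) (GRing.isLinear.Build _ _ _ _ (q : R^o -> _) q_lin).
exists (submodule hT0 * submodule hN)%type, (submodule hT0); split; last first.
- exists (submodule hN), idfun; exact: (Bijective (fun=> erefl) (fun=> erefl)).
- exists Q; split.
    apply/seteqP; split=> // t _; have [r rE] := submodule_valP t.
    by exists r => //; apply: val_inj.
  apply/seteqP; split=> r /=.
    move=> /(congr1 val) /= rz; apply: Nz_m; rewrite [_ *: _]rz; exact: hN.1.
  by move=> mr; apply: val_inj; rewrite /= mz.
exists ('rV[R]_b), ('rV[R]_mu), Inc, relations, cover; split.
- by split; [apply: row_module_projective | apply: row_module_fg].
- by split; [apply: row_module_projective | apply: row_module_fg].
- move=> [t1 x1] [t2 x2]; rewrite /Inc /= /inc /=.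
  (* Directness of the sum: a multiple [r *: z] in [N] has [r] in [m], hence vanishes. *)
  have [r rE] := submodule_valP (t1 - t2).
  move=> e; have {}e : val (t1 - t2) = val (x2 - x1).
    by rewrite !submodule_valB -[val t1](addrK (val x1)) e [val t2 + _]addrC addrAC addrK.
  have : val (t1 - t2) = 0.
    by rewrite rE; apply/mz/Nz_m; rewrite -rE e; apply: submodule_valP.
  move=> t0; move: e; rewrite t0 submodule_valB => /esym/subr0_eq/val_inj ->.
  by move: t0; rewrite submodule_valB => /subr0_eq/val_inj ->.
- apply/seteqP; split=> y /=.
    case=> -[t x] _ <-; suff : Z (val t + val x) by [].
    apply: submoduleD => //; last by apply: NZ; apply: submodule_valP.
    by have [r ->] := submodule_valP t; apply: submoduleZ.
  move=> /cover_Z [r Ny]; exists (q r, to_submodule hN Ny) => //.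
  by rewrite /Inc /inc /= addrC subrK.
- by split; [apply: cover_exact | apply: cover_surj].
Qed.

End Syzygy.
End QuotientRing.

(** * The colon hypothesis and the conclusion *)

(** Suppose [n (I : n)] lies in [n I], with [I = 0 : K], and let [x n] lie in [K], so that [x] kills
    [n I]. Any [t] killing [n K] is in [I : n], so for [y] in [n] the product [y * t] is in [n I]
    and [x * y * t = 0]. Thus [x * y] is in [0 : (0 : n K) = n K], and the two colons agree. *)
Lemma socle_factor (S : comNzRingType) (n K : set S) :
    local_ring n -> artinian S -> gorenstein S -> is_ideal K ->
    colon (ideal_mul n K) n <> colon K n ->
  exists a w, [/\ n a, forall c, n c -> colon [set 0] K (c * w)
                & ~ ideal_mul n (colon [set 0] K) (a * w)].
Proof.
move=> n_local S_art S_gor hK neq; apply: contrapT => none; apply: neq.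
have nKK : ideal_mul n K `<=` K.
  by apply: ideal_gen_sub => // _ [x [y [_ Ky ->]]]; apply: idealM.
apply/seteqP; split=> x hx y ny; first exact: (nKK _ (hx _ ny)).
apply: (double_annihilator n_local S_gor.1 S_art S_gor (ideal_gen_is_ideal _)) => t ht /=.
have : ideal_mul n (colon [set 0] K) (y * t).
  apply: contrapT => hyt; apply: none; exists y, t; split=> // c nc k Kk /=.
  by rewrite [c * t]mulrC -mulrA; exact: (ht _ (ideal_mul_mem nc Kk)).
rewrite -mulrA.
apply: (ideal_gen_sub (I := [set s | x * s = 0])) => [|_ [c [d [nc Id ->]]]] /=.
  split; first by rewrite /= mulr0.
  by move=> a u v /= u0 v0; rewrite mulrDr mulrCA u0 v0 mulr0 addr0.
by rewrite mulrA mulrC; exact: (Id _ (hx _ nc)).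
Qed.

Theorem theorem1p1 (S : comNzRingType) (n : set S)
    (S_local : local_ring n) (S_artinian : artinian S)
    (S_gorenstein : gorenstein S)
    (K : set S) (K_ideal : is_ideal K)
    (R : comAlgType S) (m : set R) (R_local : local_ring m)
    (R_surj : surjective_map (fun s : S => s%:A : R))
    (R_ker : [set s : S | s%:A = 0 :> R] = colon [set 0] K)
    (K_fitt : Fitt1 (K : set S^o) = n)
    (K_colon : colon (ideal_mul n K) n <> colon K n) :
  exists M' T : lmodType R,
    [/\ second_syzygy (canonical_module R) M',
        is_quotient_by m T
      & direct_summand T M'].
Proof.
have [a [w [na Iw nIaw]]] := socle_factor S_local S_artinian S_gorenstein K_ideal K_colon.
have K_double := double_annihilator S_local S_gorenstein.1 S_artinian S_gorenstein K_ideal.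
(* [Fitt1] is a union over presentations; the one used is a witness for [a], whose entries generate
   an ideal containing [a]. *)
move: (na); rewrite -K_fitt => -[mu [b [phi [p [pres phi_a]]]]].
have phi_n i j : n (phi i j).
  rewrite -K_fitt; exists mu, b, phi, p; split=> //.
  by apply: sub_ideal_gen; exists i, j.
have [_ p_range p_ker] := pres.
have [i [j nIij]] : exists i j, ~ ideal_mul n (colon [set 0] K) (phi i j * w).
  (* The [s] with [s * w] in [n I] form an ideal; if it contained every entry of [phi], it would
     contain [a]. *)
  apply: contrapT => hphi; apply: nIaw.
  pose J : set S := [set s | ideal_mul n (colon [set 0] K) (s * w)].
  have hnI : is_ideal (ideal_mul n (colon [set 0] K)) by apply: ideal_gen_is_ideal.
  apply: (ideal_gen_sub (I := J)) phi_a => [|_ [i [j ->]]].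
    split; first by rewrite /J /= mul0r; case: hnI.
    by move=> c x y hx hy; rewrite /J /= mulrDl -mulrA; apply: hnI.2.
  by apply: contrapT => hij; apply: hphi; exists i, j.
exact: (second_syzygy_summand S_local S_gorenstein.1 R_local R_surj R_ker
  (toR := in_alg R) (fun=> erefl) K_double p_range p_ker phi_n Iw nIij).
Qed.
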